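(* For every coherence space $A$, one has $(\mathrm{flag}\,A)^{\perp}\equiv \mathrm{flag}(A^{\perp})$; that is, the coherence spaces $(\mathrm{flag}\,A)^{\perp}$ and $\mathrm{flag}(A^{\perp})$ have the same web and the same coherence relation.
   Context: A coherence space $A$ is a set $|A|$ (its web, possibly infinite, whose elements are called tokens) endowed with a reflexive and symmetric binary relation on $|A|$, called coherence and written $\alpha\sim\alpha'\,[A]$. Strict coherence $\alpha\frown\alpha'\,[A]$ means $\alpha\sim\alpha'\,[A]$ and $\alpha\neq\alpha'$. Since coherence is reflexive, a coherence space is determined by its web and its (symmetric, irreflexive) strict coherence relation. The negation $A^{\perp}$ has web $|A^\perp|=|A|$, and $\alpha\sim\alpha'\,[A^{\perp}]$ iff $\alpha=\alpha'$ or not $\alpha\sim\alpha'\,[A]$. Let $2^{\omega}$ be the set of infinite words on $\{0,1\}$, with the product topology (Cantor space) and the lexicographic total order: $w_1<w_2$ iff there are a finite word $m$ and infinite words $w_1',w_2'$ with $w_1=m0w_1'$ and $w_2=m1w_2'$. For a coherence space $A$, the coherence space $\mathrm{flag}\,A$ is defined as follows. Its web is the set of continuous functions from $2^\omega$ to $|A|$, where $|A|$ has the discrete topology. Two functions $f,g$ in this web are strictly coherent, $f\frown g\,[\mathrm{flag}\,A]$, iff there exists $w\in 2^\omega$ such that $f(w)\frown g(w)\,[A]$ and $f(w')=g(w')$ for all $w'<w$. *)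

(* Defs.v *)
From mathcomp Require Import all_boot all_classical.
From mathcomp Require Import topology function_spaces cantor.
Set Implicit Arguments.
Unset Strict Implicit.
Unset Printing Implicit Defensive.

Record coherence_space := CoherenceSpace {
  web : Type;
  coh : web -> web -> Prop;
  coh_refl : forall a, coh a a;
  coh_sym : forall a b, coh a b -> coh b a
}.

Definition scoh (A : coherence_space) (a b : web A) : Prop :=
  coh a b /\ a <> b.

Definition neg_coh (A : coherence_space) (a b : web A) : Prop :=
  a = b \/ ~ coh a b.

Lemma neg_coh_refl (A : coherence_space) (a : web A) : neg_coh a a.
Proof. by left. Qed.

Lemma neg_coh_sym (A : coherence_space) (a b : web A) :
  neg_coh a b -> neg_coh b a.
Proof. by case=> [->|nab]; [left|right=> /coh_sym]. Qed.

Definition neg (A : coherence_space) : coherence_space :=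
  CoherenceSpace (@neg_coh_refl A) (@neg_coh_sym A).

(* An infinite word is an element of the library's [cantor_space], the product
   of [nat] copies of the discrete space [bool]; the letter 0 is [false] and
   the letter 1 is [true]. *)
Definition cons_word (b : bool) (w : cantor_space) : cantor_space :=
  fun n => if n is k.+1 then w k else b.

Definition cat_word (m : seq bool) (w : cantor_space) : cantor_space :=
  foldr cons_word w m.

Definition word_lt (w1 w2 : cantor_space) : Prop :=
  exists m w1' w2', w1 = cat_word m (cons_word false w1') /\
                    w2 = cat_word m (cons_word true w2').

(* [{classic _}] only equips the web with the choice structure that the library
   requires of every topological space. *)
Definition flag_web (A : coherence_space) : Type :=
  continuousType cantor_space (discrete_topology {classic (web A)}).

Definition flag_val (A : coherence_space) (f : flag_web A)
  (w : cantor_space) : web A := f w.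

Definition flag_scoh (A : coherence_space) (f g : flag_web A) : Prop :=
  exists w : cantor_space, scoh (flag_val f w) (flag_val g w) /\
    forall w', word_lt w' w -> flag_val f w' = flag_val g w'.

Definition flag_coh (A : coherence_space) (f g : flag_web A) : Prop :=
  f = g \/ flag_scoh f g.

Lemma flag_coh_refl (A : coherence_space) (f : flag_web A) : flag_coh f f.
Proof. by left. Qed.

Lemma flag_coh_sym (A : coherence_space) (f g : flag_web A) :
  flag_coh f g -> flag_coh g f.
Proof.
case=> [->|[w [[fgw nfg] fg]]]; [by left | right; exists w; split].
  by split; [exact: coh_sym | exact: nesym].
by move=> w' /fg.
Qed.

Definition flag (A : coherence_space) : coherence_space :=
  CoherenceSpace (@flag_coh_refl A) (@flag_coh_sym A).

(* [flag_scoh] is irreflexive, hence it is the strict coherence of [flag A]. *)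
Lemma scoh_flag (A : coherence_space) (f g : web (flag A)) :
  scoh f g <-> flag_scoh f g.
Proof.
split=> [[[]]//|fg]; split; first by right.
by move=> eq_fg; case: fg => w [[_]]; rewrite eq_fg.
Qed.

(* Main.v *)
(** Two distinct continuous functions [f] and [g] differ on a closed nonempty
    set of words, which has a lexicographically least element [w]. Any witness
    of [f] and [g] being strictly coherent in [flag A] or in [flag (neg A)] is
    that word [w], so exactly one of the two holds, according to whether [f w]
    and [g w] are coherent in [A] or not. *)
From mathcomp Require Import all_boot all_classical.
From mathcomp Require Import topology function_spaces cantor.
Require Import Defs.
Set Implicit Arguments.
Unset Strict Implicit.
Unset Printing Implicit Defensive.

(** The words agreeing with [w] below [n] form the basic neighbourhoods of [w] in Cantor space. *)
Definition agree (n : nat) (w w' : cantor_space) : Prop :=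
  forall k, k < n -> w k = w' k.

Lemma agree_leq m n w w' : m <= n -> agree n w w' -> agree m w w'.
Proof. by move=> mn ww' k km; apply: ww'; exact: leq_trans km mn. Qed.

Lemma agree_trans n w1 w2 w3 : agree n w1 w2 -> agree n w2 w3 -> agree n w1 w3.
Proof. by move=> w12 w23 k kn; rewrite w12 ?w23. Qed.

Lemma agree_sym n w w' : agree n w w' -> agree n w' w.
Proof. by move=> ww' k kn; rewrite ww'. Qed.

Lemma word_ltP (w1 w2 : cantor_space) : word_lt w1 w2 <->
  exists n, [/\ agree n w1 w2, w1 n = false & w2 n = true].
Proof.
split=> [[m [v1 [v2 [-> ->]]]]|[n]].
  exists (size m); elim: m => [|b m [ag e1 e2]]; first by split.
  by split=> // -[//|k]; exact: ag.
elim: n w1 w2 => [|n IHn] w1 w2 [ag e1 e2].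
  exists [::], (fun n => w1 n.+1), (fun n => w2 n.+1).
  by split; apply/funext => -[|n].
have [|m [v1 [v2 [eq1 eq2]]]] := IHn (fun n => w1 n.+1) (fun n => w2 n.+1).
  by split=> // k kn; exact: ag.
exists (w1 0 :: m), v1, v2; split; apply/funext => -[|k] //=.
- by rewrite -eq1.
- by rewrite ag.
- by rewrite -eq2.
Qed.

Lemma word_lt_total (w1 w2 : cantor_space) :
  w1 <> w2 -> word_lt w1 w2 \/ word_lt w2 w1.
Proof.
move=> neq; have ex : exists n, w1 n != w2 n.
  apply: contrapT => /forallNP eq; apply: neq; apply/funext => n.
  by have /negP := eq n; rewrite negbK => /eqP.
case: (ex_minnP ex) => n neqn minn.
have ag : agree n w1 w2.
  by move=> k kn; apply: contraTeq kn => /minn; rewrite -leqNgt.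
case e1: (w1 n) neqn; case e2: (w2 n) => // _; [right|left]; apply/word_ltP.
  by exists n; split=> //; exact: agree_sym.
by exists n.
Qed.

(* The least word is built one letter at a time: [next n u] is a word of [D]
   that agrees with [u] below [n] and has letter 0 at [n] whenever possible. *)
Lemma closed_word_least (D : cantor_space -> Prop) (w0 : cantor_space) :
  (forall w, (forall n, exists2 w', D w' & agree n w' w) -> D w) -> D w0 ->
  exists2 w, D w & forall w', word_lt w' w -> ~ D w'.
Proof.
move=> clD Dw0.
have /choice[next nextP] : forall nu : nat * cantor_space, exists v,
    [/\ agree nu.1 v nu.2, D nu.2 -> D v &
        forall x, D x -> agree nu.1 x nu.2 -> x nu.1 = false -> v nu.1 = false].
  move=> [n u] /=.
  have [[v [Dv vu vn]]|none] :=
    pselect (exists v, [/\ D v, agree n v u & v n = false]); first by exists v.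
  (* Without such a word in [D], keeping [u] makes the last clause vacuous. *)
  by exists u; split=> // x Dx xu xn; case: none; exists x.
pose u := fix u n := if n is k.+1 then next (k, u k) else w0.
have Du n : D (u n) by elim: n => //= n; case: (nextP (n, u n)).
(* Stage [n.+1] fixes letter [n] and later stages preserve it, so the diagonal [w] is the limit of
   the [u n]. *)
pose w : cantor_space := fun n => u n.+1 n.
have uw n : agree n (u n) w.
  elim: n => // n IHn k; rewrite ltnS leq_eqVlt => /predU1P[-> //|kn].
  by have [/(_ k kn) /= -> _ _] := nextP (n, u n); exact: IHn.
exists w; first by apply: clD => n; exists (u n).
(* A smaller [w'] in [D], first differing from [w] at [n], agrees with [u n] below [n] and has
   letter 0 there, which forces [w n] to be 0. *)
move=> w' /word_ltP[n [w'w w'n wn]] Dw'.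
have [_ _ /(_ w' Dw')] := nextP (n, u n).
have: agree n w' (u n) by apply: agree_trans w'w _; exact/agree_sym/uw.
move=> /[swap] /[apply] /(_ w'n) /= eqn.
by move: wn; rewrite /w /= eqn.
Qed.

Lemma cvg_agree (u : nat -> cantor_space) (w : cantor_space) :
  (forall n, agree n (u n) w) -> (u @ \oo --> w)%classic.
Proof.
move=> uw; apply/(@pointwise_cvgP nat bool) => k; apply: cvg_near_cst.
by exists k.+1 => // n /= kn; exact: uw.
Qed.

(** Otherwise words sharing ever longer prefixes with [w] converge to [w] while [f] avoids its value
    at [w], although singletons are open. *)
Lemma flag_val_locally_constant (A : coherence_space) (f : flag_web A) w :
  exists n, forall w', agree n w' w -> flag_val f w' = flag_val f w.
Proof.
apply: contrapT => /forallNP H.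
have /choice[u uP] n : exists w', agree n w' w /\ flag_val f w' <> flag_val f w.
  by have /existsNP[w' /not_implyP ?] := H n; exists w'.
have uw : (u @ \oo --> w)%classic by apply: cvg_agree => n; have [] := uP n.
have := continuous_cvg _ (@cts_fun _ _ f w) uw.
move=> /(_ _ _ (discrete_set1 _)) [n _ /(_ n (leqnn n)) /=].
by have [] := uP n.
Qed.

Lemma flag_first_difference (A : coherence_space) (f g : flag_web A) :
  f <> g -> exists w, flag_val f w <> flag_val g w /\
    forall w', word_lt w' w -> flag_val f w' = flag_val g w'.
Proof.
move=> neq.
have [w0 neq0] : exists w, flag_val f w <> flag_val g w.
  by apply/existsNP => fg; apply: neq; apply/continuousEP => w; exact: fg.
have [|w neqw minw] :=
    @closed_word_least (fun w => flag_val f w <> flag_val g w) w0 _ neq0.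
  (* The difference set is closed: both maps are constant on the words agreeing with [w] below
     [maxn n m]. *)
  move=> w cl; have [n fn] := flag_val_locally_constant f w.
  have [m gm] := flag_val_locally_constant g w.
  have [w' neqw' w'w] := cl (maxn n m).
  have fw : flag_val f w' = flag_val f w.
    by apply: fn; apply: agree_leq w'w; exact: leq_maxl.
  have gw : flag_val g w' = flag_val g w.
    by apply: gm; apply: agree_leq w'w; exact: leq_maxr.
  by rewrite -fw -gw.
by exists w; split=> // w' /minw /contrapT.
Qed.

Lemma scoh_neg (A : coherence_space) (a b : web A) :
  @scoh (neg A) a b <-> ~ coh a b.
Proof.
split=> [[[//|]]//|nab]; split; first by right.
by move=> ab; apply: nab; rewrite ab; exact: coh_refl.
Qed.

Lemma flag_scoh_neg (A : coherence_space) (f g : flag_web A) :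
  f <> g -> ~ flag_scoh f g <-> @flag_scoh (neg A) f g.
Proof.
move=> neq; split=> [nfg|[w [/scoh_neg nw eqw]] [v [[cv nv] eqv]]].
  have [w [neqw eqw]] := flag_first_difference neq.
  exists w; split=> //; apply/scoh_neg => cw.
  by apply: nfg; exists w.
(* If the witnesses were distinct, [f] and [g] would agree at the lesser one, where they must
   differ. *)
have [eq|/word_lt_total[/eqv fg|/eqw/nv//]] := pselect (w = v).
  by apply: nw; rewrite eq.
by apply: nw; rewrite /flag_val in fg *; rewrite fg; exact: coh_refl.
Qed.

(** Extensionality identifies the relations; proof irrelevance then identifies the remaining
    fields. *)
Lemma coherence_space_ext (T : Type) (c d : T -> T -> Prop)
    (cr : forall a, c a a) (cs : forall a b, c a b -> c b a)
    (dr : forall a, d a a) (ds : forall a b, d a b -> d b a) :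
  (forall a b, c a b <-> d a b) -> CoherenceSpace cr cs = CoherenceSpace dr ds.
Proof.
move=> cd; have eq : c = d by apply/funext => a; apply/funext => b; apply/propext.
by case: _ / eq in dr ds *; congr CoherenceSpace; exact: Prop_irrelevance.
Qed.

Theorem proposition16 (A : coherence_space) : neg (flag A) = flag (neg A).
Proof.
(* Since [neg] keeps the web, both sides have web [flag_web A] by conversion. *)
apply: (@coherence_space_ext (flag_web A)) => f g.
rewrite /neg_coh /= /flag_coh; have [->|neq] := pselect (f = g).
  by split=> _; left.
split=> -[//|H]; right.
  by apply/(flag_scoh_neg neq) => fg; apply: H; right.
by case=> //; apply/(flag_scoh_neg neq).
Qed.
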